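(* Let $X$ be a Priestley space. Then: (1) $H(X)$ is a Priestley space (ordered by inclusion). (2) The map $(F,G)\mapsto F\vee G:=F\cup G$ is a continuous semilattice operation on $H(X)$. (3) $X$ is topologically embeddable in $H(X)$ by the increasing continuous map $\eta: x\mapsto {\downarrow}x$. Moreover, if $X$ is a compact Skula space, ordered by $\le$ as induced by a clopen selector for $X$, then $(X,\le)$ is a Priestley space and: (4) Any nonempty closed initial subset $K$ of $X$, i.e. any member of $H(X)$, is a finite union of clopen principal ideals of $X$; in particular $K$ is clopen. (5) $H(X)$ is a Skula space. (6) The family $\{K^+ : K\in H(X)\}$ is a clopen selector for $H(X)$.
   Context: In a poset, ${\downarrow}p=\{q:q\le p\}$ is the principal ideal of $p$; $S$ is initial if $x\in S$, $y\le x$ imply $y\in S$, and final if $x\in S$, $y\ge x$ imply $y\in S$. A Priestley space is a compact Hausdorff space $X$ with a partial order such that whenever $x\not\le y$ there is a clopen final set $V$ with $x\in V$, $y\notin V$. For a Priestley space $X$, the hyperspace $H(X)$ is the set of all nonempty closed initial subsets of $X$, ordered by inclusion, with the topology generated by the sets $U^+=\{K\in H(X):K\subseteq U\}$ and $V^-=\{K\in H(X): K\cap V\ne\emptyset\}$, where $U$ ranges over clopen initial subsets and $V$ over clopen final subsets of $X$. A Hausdorff space $X$ is a Skula space if its topology is generated by the base $\{U\setminus V : U,V\in\mathcal T\}$ for some topology $\mathcal T$ on $X$. A clopen selector for a space $Y$ is a family $\{U_y : y\in Y\}$ of clopen subsets of $Y$ such that: (1) $y\in U_y$ for every $y$; (2)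 for distinct $x,y$, either $x\notin U_y$ or $y\notin U_x$; (3) if $y\in U_x$ then $U_y\subseteq U_x$. It induces the partial order $x\le y$ iff $U_x\subseteq U_y$, for which $U_x={\downarrow}x$. A compact Hausdorff space is Skula iff it admits a clopen selector. In (6), the member of the selector associated with the point $K\in H(X)$ is $K^+=\{L\in H(X): L\subseteq K\}$. *)

(* Defs.v *)
From HB Require Import structures.
From mathcomp Require Import all_boot all_order.
From mathcomp Require Import all_classical topology.

Set Implicit Arguments.
Unset Strict Implicit.
Unset Printing Implicit Defensive.

Local Open Scope classical_set_scope.

Section Posets.
Context {X : Type}.
Implicit Types (le : rel X) (S : set X).

Definition partial_order le :=
  [/\ reflexive le, antisymmetric le & transitive le].

Definition principal_ideal le (p : X) : set X := [set q | le q p].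

Definition initial_set le S := forall x y, S x -> le y x -> S y.

Definition final_set le S := forall x y, S x -> le x y -> S y.

End Posets.

Definition priestley (X : topologicalType) (le : rel X) :=
  [/\ compact [set: X],
      hausdorff_space X,
      partial_order le &
      forall x y, ~~ le x y ->
        exists V : set X, [/\ clopen V, final_set le V, V x & ~ V y]].

Record hyperspace (X : topologicalType) (le : rel X) := Hyperspace {
  hset :> set X;
  hset_prop : [/\ hset !=set0, closed hset & initial_set le hset]
}.

Section Hyperspace.
Context {X : topologicalType} (le : rel X).
Implicit Types (U V A : set X) (K L F G : hyperspace le).

Definition hyper_le : rel (hyperspace le) := fun K L => `[< K `<=` L >].

Definition hplus A : set (hyperspace le) := [set K | K `<=` A].

Definition hminus A : set (hyperspace le) := [set K | K `&` A !=set0].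

Definition hyper_subbase : set (set (hyperspace le)) :=
  [set hplus U | U in [set U | clopen U /\ initial_set le U]] `|`
  [set hminus V | V in [set V | clopen V /\ final_set le V]].

HB.instance Definition _ := gen_eqMixin (hyperspace le).
HB.instance Definition _ := gen_choiceMixin (hyperspace le).
HB.instance Definition _ :=
  isSubBaseTopological.Build (hyperspace le) hyper_subbase id.

Lemma hyper_join_prop F G :
  [/\ F `|` G !=set0, closed (F `|` G) & initial_set le (F `|` G)].
Proof.
have [[x Fx] cF iF] := hset_prop F; have [_ cG iG] := hset_prop G; split.
- by exists x; left.
- exact: closedU.
- by move=> y z [Fy|Gy] zy; [left; exact: iF zy|right; exact: iG zy].
Qed.

Definition hyper_join F G : hyperspace le := Hyperspace (hyper_join_prop F G).

Lemma ideal_prop (leP : priestley le) (x : X) :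
  [/\ principal_ideal le x !=set0, closed (principal_ideal le x) &
      initial_set le (principal_ideal le x)].
Proof.
case: leP => _ _ [le_refl _ le_trans] sep; split.
- by exists x; exact: le_refl.
- move=> y cly; apply: contrapT => /negP /sep[V [[oV _] fV Vy nVx]].
  have [z [zx Vz]] := cly V (open_nbhs_nbhs (conj oV Vy)).
  exact: nVx (fV _ _ Vz zx).
- by move=> y z yx zy; exact: le_trans zy yx.
Qed.

Definition hyper_eta (leP : priestley le) (x : X) : hyperspace le :=
  Hyperspace (ideal_prop leP x).

End Hyperspace.

(* Injective, continuous, and open onto the range with its subspace topology. *)
Definition topological_embedding (S T : topologicalType) (f : S -> T) :=
  [/\ injective f, continuous f &
      forall A : set S, open A ->
        exists2 B : set T, open B & f @` A = range f `&` B].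

(* The empty set is the union of the empty subfamily. *)
Definition is_topology (X : Type) (T : set (set X)) :=
  [/\ T [set: X], setI_closed T &
      forall F : set (set X), F `<=` T -> T (\bigcup_(A in F) A)].

Definition skula_space (X : topologicalType) :=
  hausdorff_space X /\
  exists2 T : set (set X), is_topology T &
    basis [set U `\` V | U in T & V in T].

Definition clopen_selector (Y : topologicalType) (U : Y -> set Y) :=
  [/\ forall y, clopen (U y),
      forall y, U y y,
      forall x y, x <> y -> ~ U y x \/ ~ U x y &
      forall x y, U x y -> U y `<=` U x].

Definition selector_le (Y : Type) (U : Y -> set Y) : rel Y :=
  fun x y => `[< U x `<=` U y >].

(* Main.v *)
Require Import Defs.
From mathcomp Require Import all_boot all_order finmap.
From mathcomp Require Import all_classical topology.

(** The single topological tool is [compact_bigcap_sub]: if the intersection of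
    a family of closed sets that is stable under finite intersections lies in an
    open set, then so does a member of the family.

    In a Priestley space it is first applied to the clopen final neighbourhoods
    of a point [x], whose intersection is [{y | x <= y}]: any closed initial set
    missing [x] misses a clopen final neighbourhood [V] of [x].  Then [V^-] is a
    clopen final subset of the hyperspace (its complement is [(~V)^+]), and this
    is the Priestley separation in [H(X)], from which the Hausdorff property
    follows by antisymmetry.  For compactness, the limit of an ultrafilter [F] on
    [H(X)] is the intersection of the clopen initial sets [U] with [U^+] in [F];
    the tool gives both its nonemptiness and the convergence ([hyper_compact]).
    Continuity of the join and of [eta] is read off on the subbase: [eta] pulls
    [U^+] and [V^-] back to [U] and [V], and the join pulls [U^+] back to pairs
    with both members in [U^+], and [V^-] to pairs with one member in [V^-].  As a
    continuous injection of a compact space in a Hausdorff space, [eta] is then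
    an embedding.

    For a clopen selector [U], the members [U x] are the principal ideals and
    they are clopen.  So a closed initial set [K] is a compact set that is the
    union of its clopen subsets [U x], hence a finite union of them, and [K] is
    clopen ([closed_initial_clopen]).  It follows that the open final sets are clopen and form a topology,
    and that this topology witnesses the Skula property: a point [y] has the
    neighbourhoods [V `&` U y] with [V] clopen final, that is [V `\` ~` U y],
    and those sets form a base at [y] by the tool again, because their
    intersection consists of the points that are both above and below [y], hence
    of [y] alone ([selector_skula]).  This holds for any compact Hausdorff space
    with a clopen selector, and [K |-> K^+] is one for [H(X)] because every [K] is
    clopen; hence [H(X)] is Skula too. *)

Set Implicit Arguments.
Unset Strict Implicit.
Unset Printing Implicit Defensive.

Local Open Scope classical_set_scope.

(** * A compactness principle *)

(** Otherwise the traces of the family on [~` W] generate a proper filter, and a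
    cluster point of that filter lies in every member of the family and outside
    [W]. *)
Lemma compact_bigcap_sub (X : topologicalType) (D : set (set X)) (W : set X) :
  compact [set: X] -> D !=set0 -> (forall A, D A -> closed A) ->
  setI_closed D -> open W -> \bigcap_(A in D) A `<=` W ->
  exists2 A, D A & A `<=` W.
Proof.
move=> cX D0 Dcl DI oW DW; apply: contrapT => noA.
pose F := filter_from D (fun A => A `&` ~` W).
have FF : ProperFilter F.
  apply: filter_from_proper.
    apply: filter_from_filter => // A B DA DB.
    by exists (A `&` B); [exact: DI|move=> x [[Ax Bx] nWx]].
  move=> A DA; apply: contrapT => A0; apply: noA; exists A => // x Ax.
  by apply: contrapT => nWx; apply: A0; exists x.
have [p [_ clp]] := cX F FF filterT.
have pA A : D A -> (A `&` ~` W) p.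
  move=> DA; have : closed (A `&` ~` W).
    by apply: closedI; [exact: Dcl|exact: open_closedC].
  by apply => B nB; apply: clp => //; exists A.
have [A DA] := D0; case: (pA A DA) => _; apply.
by apply: DW => B /pA[].
Qed.

(** * Initial and final sets *)

Section InitialFinal.
Context {X : topologicalType} (le : rel X).
Implicit Types (A B U V : set X).

Lemma initial_setC A : final_set le A -> initial_set le (~` A).
Proof. by move=> fA x y nAx yx Ay; apply: nAx; exact: fA Ay yx. Qed.

Lemma final_setC A : initial_set le A -> final_set le (~` A).
Proof. by move=> iA x y nAx xy Ay; apply: nAx; exact: iA Ay xy. Qed.

Lemma initial_setI A B :
  initial_set le A -> initial_set le B -> initial_set le (A `&` B).
Proof. by move=> iA iB x y [Ax Bx] yx; split; [exact: iA yx|exact: iB yx]. Qed.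

Lemma final_setI A B :
  final_set le A -> final_set le B -> final_set le (A `&` B).
Proof. by move=> iA iB x y [Ax Bx] yx; split; [exact: iA yx|exact: iB yx]. Qed.

(** The intersection of the clopen final neighbourhoods of [x] is
    [{y | le x y}], so compactness lets one of them witness any open property
    shared by the points above [x]. *)
Lemma priestley_final_nbhs x W : priestley le -> open W ->
  (forall y, le x y -> W y) ->
  exists V, [/\ clopen V, final_set le V, V x & V `<=` W].
Proof.
case=> cX _ _ sep oW xW.
have [] := @compact_bigcap_sub X
  [set V | [/\ clopen V, final_set le V & V x]] W cX.
- by exists setT; split=> //; exact: clopenT.
- by move=> A [[]].
- move=> A B [cA fA Ax] [cB fB Bx].
  by split=> //; [exact: clopenI|exact: final_setI].
- exact: oW.
- move=> y yD; apply: xW; apply: contrapT => /negP /sep[V [cV fV Vx nVy]].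
  by apply: nVy; apply: yD.
- by move=> V [cV fV Vx] VW; exists V.
Qed.

End InitialFinal.

(** * Topology of the hyperspace *)

Section Hyperspace.
Context {X : topologicalType} {le : rel X}.
Implicit Types (U V A : set X) (K L F G : hyperspace le).

Lemma hset_inj K L : hset K = hset L -> K = L.
Proof.
case: K L => [A pA] [B pB] /= AB; rewrite AB in pA *.
by rewrite (Prop_irrelevance pA pB).
Qed.

Lemma hminusE A : @hminus X le A = ~` hplus (~` A).
Proof.
apply/seteqP; split => [K [x [Kx Ax]] KA|K nKA]; first exact: KA Kx Ax.
apply: contrapT => K0; apply: nKA => x Kx Ax; apply: K0.
by exists x.
Qed.

Lemma hplusE A : @hplus X le A = ~` hminus (~` A).
Proof. by rewrite hminusE !setCK. Qed.

Lemma open_hyper_subbase (A : set (hyperspace le)) : hyper_subbase A -> open A.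
Proof.
move=> sA; exists [set A]; last by rewrite bigcup_set1.
move=> _ ->; exists [fset A]%fset.
  by move=> B /fset1P ->; rewrite inE.
by rewrite set_fset1 bigcap_set1.
Qed.

Lemma open_hplus U : clopen U -> initial_set le U -> open (@hplus X le U).
Proof. by move=> cU iU; apply: open_hyper_subbase; left; exists U. Qed.

Lemma open_hminus V : clopen V -> final_set le V -> open (@hminus X le V).
Proof. by move=> cV fV; apply: open_hyper_subbase; right; exists V. Qed.

Lemma clopen_hplus U : clopen U -> initial_set le U -> clopen (@hplus X le U).
Proof.
move=> cU iU; split; first exact: open_hplus.
rewrite hplusE; apply: open_closedC.
by apply: open_hminus; [exact: clopenC|exact: final_setC].
Qed.

Lemma clopen_hminus V : clopen V -> final_set le V -> clopen (@hminus X le V).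
Proof.
move=> cV fV; rewrite hminusE; apply: (clopenC set0).
by apply: clopen_hplus; [exact: clopenC|exact: initial_setC].
Qed.

Lemma hyper_cvg (F : set_system (hyperspace le)) K : Filter F ->
  (forall U, clopen U -> initial_set le U -> K `<=` U -> F (hplus U)) ->
  (forall V, clopen V -> final_set le V -> K `&` V !=set0 -> F (hminus V)) ->
  F --> K.
Proof.
move=> FF Fplus Fminus A; rewrite nbhsE => -[B [oB BK] BA].
apply: filterS BA _; case: oB => C sC BE.
have : (\bigcup_(i in C) i) K by move: BK; rewrite -BE.
move=> [E CE EK].
have : F E.
  have [D sD DE] := sC _ CE; rewrite -DE; apply: filter_bigI => i iD.
  have Ki : i K by rewrite -DE in EK; exact: EK.
  have := sD _ iD; rewrite inE => -[[U [cU iU] Ui]|[V [cV fV] Vi]].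
    by rewrite -Ui; apply: Fplus => //; rewrite -Ui in Ki.
  by rewrite -Vi; apply: Fminus => //; rewrite -Vi in Ki.
by apply: filterS => L EL; rewrite -BE; exists E.
Qed.

Lemma hyper_continuous (S : topologicalType) (f : S -> hyperspace le) :
  (forall U, clopen U -> initial_set le U -> open (f @^-1` hplus U)) ->
  (forall V, clopen V -> final_set le V -> open (f @^-1` hminus V)) ->
  continuous f.
Proof.
move=> fplus fminus s; apply: hyper_cvg => A cA mA KA;
  apply: open_nbhs_nbhs; split=> //; [exact: fplus|exact: fminus].
Qed.

(** * The hyperspace of a Priestley space is a Priestley space *)

Lemma hyper_le_order : partial_order (@hyper_le X le).
Proof.
split=> [K|K L|L K M].
- by apply/asboolP.
- by move=> /andP[/asboolP KL /asboolP LK]; apply/hset_inj/seteqP; split.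
- by move=> /asboolP KL /asboolP LM; apply/asboolP; exact: subset_trans LM.
Qed.

Lemma hyper_priestley_separation K L : priestley le -> ~~ hyper_le K L ->
  exists V : set (hyperspace le),
    [/\ clopen V, final_set (@hyper_le X le) V, V K & ~ V L].
Proof.
move=> leP /asboolPn KL.
have [x [Kx nLx]] : exists x, hset K x /\ ~ hset L x.
  apply: contrapT => nx; apply: KL => x Kx.
  by apply: contrapT => nLx; apply: nx; exists x.
have [_ cL iL] := hset_prop L.
have [y xy|V [cV fV Vx VL]] := priestley_final_nbhs leP (closed_openC cL)
  (x := x).
  by move=> Ly; apply: nLx; exact: iL Ly xy.
exists (hminus V); split.
- exact: clopen_hminus.
- by move=> M N [y [My Vy]] /asboolP MN; exists y; split=> //; exact: MN.
- by exists x.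
- by move=> [y [Ly Vy]]; exact: VL Vy Ly.
Qed.

Lemma hyper_hausdorff : priestley le -> hausdorff_space (hyperspace le).
Proof.
move=> leP K L clKL; have [_ hanti _] := hyper_le_order.
apply: hanti; apply/andP; split; apply: contrapT => /negP
  /(hyper_priestley_separation leP)[V [[oV cV] _ VK nVL]].
  have [M [VM nVM]] := clKL _ _ (open_nbhs_nbhs (conj oV VK))
    (open_nbhs_nbhs (conj (closed_openC cV) nVL)).
  exact: nVM VM.
have [M [nVM VM]] := clKL _ _ (open_nbhs_nbhs (conj (closed_openC cV) nVL))
  (open_nbhs_nbhs (conj oV VK)).
exact: nVM VM.
Qed.

(** An ultrafilter [F] must converge to the smallest candidate allowed by its
    members of the form [U^+].  If [V^-] is not in [F] for a clopen final [V],
    then its complement [(~` V)^+] is, so that the candidate misses [V]. *)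
Lemma hyper_compact : compact [set: X] -> compact [set: hyperspace le].
Proof.
move=> cX; rewrite compact_ultra => F UF _.
pose D := [set U | [/\ clopen U, initial_set le U & F (@hplus X le U)]].
have D0 : D !=set0.
  by exists setT; split=> //; [exact: clopenT|exact: filterS filterT].
have Dcl U : D U -> closed U by case=> -[].
have DI : setI_closed D.
  move=> U V [cU iU FU] [cV iV FV]; split.
  - exact: clopenI.
  - exact: initial_setI.
  - by apply: filterS (filterI FU FV) => L [LU LV] x Lx; split;
      [exact: LU|exact: LV].
have K0 : \bigcap_(U in D) U !=set0.
  apply: contrapT => K0.
  have [|U [_ _ FU] U0] := compact_bigcap_sub cX D0 Dcl DI open0.
    by move=> x Dx; apply: K0; exists x.
  have [L LU] := filter_ex FU.
  by have [[x Lx] _ _] := hset_prop L; exact: U0 (LU _ Lx).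
have Kprop : [/\ \bigcap_(U in D) U !=set0, closed (\bigcap_(U in D) U) &
    initial_set le (\bigcap_(U in D) U)].
  split=> //; first exact: closed_bigI.
  by move=> x y Dx yx U DU; case: (DU) => _ iU _; exact: iU (Dx U DU) yx.
exists (Hyperspace Kprop); split=> //; apply: hyper_cvg.
- move=> U [oU _] iU KU.
  have [V [_ _ FV] VU] := compact_bigcap_sub cX D0 Dcl DI oU KU.
  by apply: filterS FV => L LV; exact: subset_trans VU.
- move=> V cV fV [x [Kx Vx]].
  have [//|FnV] := in_ultra_setVsetC (hminus V) UF.
  rewrite hminusE setCK in FnV.
  have /Kx /(_ Vx)// : D (~` V).
  by split=> //; [exact: clopenC|exact: initial_setC].
Qed.

Lemma hyper_priestley : priestley le -> priestley (@hyper_le X le).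
Proof.
move=> leP; split.
- by case: leP => cX _ _ _; exact: hyper_compact.
- exact: hyper_hausdorff.
- exact: hyper_le_order.
- by move=> K L; exact: hyper_priestley_separation.
Qed.

(** * The join and the embedding by principal ideals *)

Lemma hyper_join_continuous :
  continuous (fun FG : hyperspace le * hyperspace le => hyper_join FG.1 FG.2).
Proof.
have open1 (A : set (hyperspace le)) : open A ->
    open [set FG : hyperspace le * hyperspace le | A FG.1].
  by move=> oA; apply: (open_comp (f := fst)) => // ? _; exact: cvg_fst.
have open2 (A : set (hyperspace le)) : open A ->
    open [set FG : hyperspace le * hyperspace le | A FG.2].
  by move=> oA; apply: (open_comp (f := snd)) => // ? _; exact: cvg_snd.
apply: hyper_continuous => [U cU iU|V cV fV].
- rewrite [X in open X](_ : _ = [set FG | hplus U FG.1] `&`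
                                [set FG | hplus U FG.2]).
    by apply: openI; [apply: open1|apply: open2]; exact: open_hplus.
  apply/seteqP; split=> [[F G] FGU|[F G] [FU GU]].
    by split=> x ?; apply: FGU; [left|right].
  by move=> x [|]; [exact: FU|exact: GU].
- rewrite [X in open X](_ : _ = [set FG | hminus V FG.1] `|`
                                [set FG | hminus V FG.2]).
    by apply: openU; [apply: open1|apply: open2]; exact: open_hminus.
  apply/seteqP; split=> [[F G] [x [[Fx|Gx] Vx]]|[F G] [[x [Fx Vx]]|[x [Gx Vx]]]].
  + by left; exists x.
  + by right; exists x.
  + by exists x; split=> //; left.
  + by exists x; split=> //; right.
Qed.

Lemma hyper_joinA : associative (@hyper_join X le).
Proof. by move=> F G H; apply: hset_inj; exact: setUA. Qed.

Lemma hyper_joinC : commutative (@hyper_join X le).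
Proof. by move=> F G; apply: hset_inj; exact: setUC. Qed.

Lemma hyper_joinxx : idempotent_op (@hyper_join X le).
Proof. by move=> F; apply: hset_inj; exact: setUid. Qed.

Lemma hyper_eta_continuous (leP : priestley le) : continuous (hyper_eta leP).
Proof.
have [_ _ [le_refl _ _] _] := leP.
apply: hyper_continuous => [U [oU _] iU|V [oV _] fV].
- rewrite [X in open X](_ : _ = U)//; apply/seteqP; split=> x.
    by apply; exact: le_refl.
  by move=> Ux y yx; exact: iU Ux yx.
- rewrite [X in open X](_ : _ = V)//; apply/seteqP; split=> x.
    by case=> y [yx Vy]; exact: fV Vy yx.
  by move=> Vx; exists x; split=> //; exact: le_refl.
Qed.

Lemma hyper_eta_le (leP : priestley le) x y :
  le x y -> hyper_le (hyper_eta leP x) (hyper_eta leP y).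
Proof.
have [_ _ [_ _ le_trans] _] := leP.
by move=> xy; apply/asboolP => z zx; exact: le_trans zx xy.
Qed.

Lemma hyper_eta_inj (leP : priestley le) : injective (hyper_eta leP).
Proof.
have [_ _ [le_refl le_anti _] _] := leP => x y /(congr1 (@hset _ _)) /= xy.
apply: le_anti; apply/andP; split.
  by have : principal_ideal le x x by [exact: le_refl]; rewrite xy.
by have : principal_ideal le y y by [exact: le_refl]; rewrite -xy.
Qed.

End Hyperspace.

(** Such a map is closed, and injectivity turns closed images into relatively
    open ones by complementation. *)
Lemma compact_hausdorff_embedding (S T : topologicalType) (f : S -> T) :
  compact [set: S] -> hausdorff_space T -> injective f -> continuous f ->
  topological_embedding f.
Proof.
move=> cS hT fI fc; split=> // A oA; exists (~` (f @` (~` A))).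
  apply: closed_openC; apply: compact_closed => //.
  apply: continuous_compact; first exact: continuous_subspaceT.
  by rewrite -(setTI (~` A)); apply: compact_closedI => //; exact: open_closedC.
apply/seteqP; split=> [_ [x Ax <-]|y [[x _ <-] nfx]].
  by split=> [|[y nAy /fI yx]]; [exists x|apply: nAy; rewrite yx].
by exists x => //; apply: contrapT => nAx; apply: nfx; exists x.
Qed.

(** * Clopen selectors *)

Section Selector.
Context {Y : topologicalType} (U : Y -> set Y).
Hypothesis selU : clopen_selector U.
Let le := selector_le U.

Lemma selector_leE x y : le x y <-> U y x.
Proof.
have [_ Uxx _ Usub] := selU; split=> [/asboolP|/Usub xy]; first exact.
exact/asboolP.
Qed.

Lemma selector_ideal x : principal_ideal le x = U x.
Proof. by apply/seteqP; split=> y /selector_leE. Qed.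

Lemma selector_order : partial_order le.
Proof.
split=> [x|x y|y x z].
- by apply/asboolP; exact: subset_refl.
- move=> /andP[/selector_leE xy /selector_leE yx].
  have [_ _ Uanti _] := selU.
  by apply: contrapT => /Uanti[].
- by move=> /asboolP xy /asboolP yz; apply/asboolP; exact: subset_trans yz.
Qed.

Hypotheses (cY : compact [set: Y]) (hY : hausdorff_space Y).

Lemma selector_priestley : priestley le.
Proof.
split=> //; first exact: selector_order.
move=> x y xy; exists (~` U y); have [cU Uxx _ Usub] := selU; split.
- exact: (clopenC set0).
- by apply: final_setC => z t /Usub yz /selector_leE zt; exact: yz.
- by move=> /selector_leE; exact/negP.
- by apply.
Qed.

(** The sets [K] minus a finite union of ideals generated by points of [K] have
    empty intersection, since a point [x] of [K] lies in [U x]; so one of these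
    sets is empty. *)
Lemma closed_initial_finite_ideals (K : set Y) :
  closed K -> initial_set le K ->
  exists A, finite_set A /\ K = \bigcup_(x in A) U x.
Proof.
have [cU Uxx _ _] := selU => cK iK.
pose D := [set K `\` \bigcup_(x in A) U x | A in
            [set A | finite_set A /\ A `<=` K]].
have [|||||_ [A [finA AK] <-] KA] := @compact_bigcap_sub Y D set0 cY.
- exists (K `\` \bigcup_(x in set0) U x); exists set0 => //.
  by split; [exact: finite_set0|exact: sub0set].
- move=> _ [A [finA AK] <-]; apply: closedI => //.
  by apply: open_closedC; apply: bigcup_open => x _; case: (cU x).
- move=> _ _ [A [finA AK] <-] [B [finB BK] <-]; exists (A `|` B).
    by split; [rewrite finite_setU|rewrite subUset].
  by rewrite bigcup_setU setDUr.
- exact: open0.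
- move=> x Dx.
  have [Kx _] : (K `\` \bigcup_(x in set0) U x) x.
    apply: Dx.
    by exists set0 => //; split; [exact: finite_set0|exact: sub0set].
  have [_] : (K `\` \bigcup_(x in [set x]) U x) x.
    by apply: Dx; exists [set x] => //; split; [exact: finite_set1|move=> _ ->].
  by rewrite bigcup_set1; apply.
- exists A; split=> //; apply/seteqP; split=> x.
    by move=> Kx; apply: contrapT => nAx; apply: (KA x).
  by move=> [y /AK Ky /selector_leE xy]; exact: iK Ky xy.
Qed.

Lemma closed_initial_clopen (K : set Y) :
  closed K -> initial_set le K -> clopen K.
Proof.
move=> cK iK; split=> //.
have [A [_ ->]] := closed_initial_finite_ideals cK iK.
by apply: bigcup_open => x _; have [/(_ x)[]] := selU.
Qed.

(** The witness is the topology of open final sets.  Such a set is the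
    complement of a closed initial set, hence clopen, so that the differences are
    open; and [V `&` U y] is one of these differences for every clopen final [V],
    the complement of the clopen initial [U y] being itself open and final. *)
Lemma selector_skula : skula_space Y.
Proof.
split=> //; exists [set V | open V /\ final_set le V].
  split.
  - by split=> //; exact: openT.
  - by move=> A B [oA fA] [oB fB]; split; [exact: openI|exact: final_setI].
  - move=> F FT; split; first by apply: bigcup_open => A /FT[].
    by move=> x y [A FA Ax] xy; exists A => //; have [_ fA] := FT _ FA;
      exact: fA Ax xy.
split.
  move=> _ [V [oV _] [W [oW fW] <-]]; apply: openI => //.
  by have [] := closed_initial_clopen (open_closedC oW) (initial_setC fW).
move=> y O; rewrite nbhsE => -[B [oB By] BO].
have [cU Uxx _ _] := selU; have [_ le_anti _] := selector_order.
(* The points above [y] lie in [B] or outside [U y]: the only one in [U y] is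
   [y] itself.  So a clopen final neighbourhood of [y] does as well. *)
have [z yz|V [[oV _] fV Vy VW]] := priestley_final_nbhs selector_priestley
  (openU oB (closed_openC (cU y).2)) (x := y).
  have [Uyz|] := pselect (U y z); last by right.
  left; rewrite (_ : z = y)//; apply: le_anti; apply/andP.
  by split=> //; exact/selector_leE.
exists (V `\` ~` U y).
  split; last by split=> //; apply.
  exists V => //; exists (~` U y) => //; split.
    by apply/closed_openC; case: (cU y).
  by apply: final_setC => z t /selector_leE zy tz; apply/selector_leE;
    have [_ _ le_trans] := selector_order; exact: le_trans tz zy.
move=> z [/VW Wz]; rewrite /= => /contrapT Uyz; apply: BO.
by case: Wz.
Qed.

Lemma hyper_selector : clopen_selector (fun K : hyperspace le => @hplus Y le K).
Proof.
split=> //.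
- move=> K; have [_ cK iK] := hset_prop K.
  by apply: clopen_hplus => //; exact: closed_initial_clopen.
- by move=> K; exact: subset_refl.
- move=> K L nKL; have [KL|] := pselect (hset K `<=` hset L); last by left.
  right => LK; apply: nKL.
  by apply/hset_inj/seteqP; split.
- by move=> K L LK M ML; exact: subset_trans LK.
Qed.

End Selector.

Theorem theorem2 (X : topologicalType) :
  (forall (le : rel X) (leP : priestley le),
    [/\ priestley (hyper_le (le := le)),
        [/\ continuous (fun FG : hyperspace le * hyperspace le =>
                          hyper_join FG.1 FG.2),
            associative (@hyper_join X le),
            commutative (@hyper_join X le) &
            idempotent_op (@hyper_join X le)] &
        [/\ topological_embedding (hyper_eta leP),
            continuous (hyper_eta leP) &
            forall x y : X, le x y ->
              hyper_le (hyper_eta leP x) (hyper_eta leP y)]]) /\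
  (forall U : X -> set X,
    compact [set: X] -> skula_space X -> clopen_selector U ->
    let le := selector_le U in
    [/\ priestley le,
        forall K : hyperspace le,
          (exists A : set X,
            [/\ finite_set A,
                forall x, A x -> clopen (principal_ideal le x) &
                hset K = \bigcup_(x in A) principal_ideal le x]) /\
          clopen (hset K),
        skula_space (hyperspace le) &
        clopen_selector (fun K : hyperspace le => @hplus X le K)]).
Proof.
split=> [le leP|U cX [hX _] selU le].
  split; first exact: hyper_priestley.
  - split; [exact: hyper_join_continuous|exact: hyper_joinA|
            exact: hyper_joinC|exact: hyper_joinxx].
  - split; [|exact: hyper_eta_continuous|exact: hyper_eta_le].
    apply: compact_hausdorff_embedding; last exact: hyper_eta_continuous.
    + by case: leP.
    + exact: hyper_hausdorff.
    + exact: hyper_eta_inj.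
have leP : priestley le by exact: selector_priestley.
have [cHX hHX _ _] := hyper_priestley leP.
have selH := hyper_selector selU cX.
split=> //; last exact: selector_skula selH cHX hHX.
move=> K; have [_ cK iK] := hset_prop K.
split; last exact: closed_initial_clopen iK.
have [A [finA KA]] := closed_initial_finite_ideals selU cX cK iK.
exists A; split=> //.
  by move=> x _; rewrite selector_ideal//; case: selU.
by rewrite KA; apply: eq_bigcupr => x _; rewrite selector_ideal.
Qed.
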